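(* For all integers $n\ge 0$, $$p_{-8}(8n+7)\equiv 0\pmod{2^{11}}.$$
   Context: For $r\in\mathbb{Z}$, the integers $p_r(n)$, $n\ge 0$, are defined by $$\sum_{n = 0}^{\infty} p_r(n)q^n = (q;q)^r_{\infty},\qquad (q;q)_{\infty} := \prod_{m=1}^{\infty}(1-q^{m}).$$ In particular $\sum_{n\ge 0}p_{-8}(n)q^n = \prod_{m\ge 1}(1-q^m)^{-8}$. *)

(* Defs.v *)
From HB Require Import structures.
From mathcomp Require Import all_boot all_order all_algebra.
From mathcomp Require Import boolp.

Set Implicit Arguments.
Unset Strict Implicit.
Unset Printing Implicit Defensive.

Import GRing.Theory.
Local Open Scope ring_scope.

Record fps (R : Type) := Fps { coefs : nat -> R }.

Section FormalPowerSeries.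
Variable R : comUnitRingType.
Implicit Types f g h : fps R.

(* Equality of power series is not decidable: the eqType and choiceType
   structures required by zmodType come from the classical axioms. *)
HB.instance Definition _ := gen_eqMixin (fps R).
HB.instance Definition _ := gen_choiceMixin (fps R).

Lemma fpsP f g : coefs f =1 coefs g -> f = g.
Proof. by case: f g => [f] [g] /= /funext ->. Qed.

Definition fps0 : fps R := Fps (fun=> 0).
Definition fps_add f g : fps R := Fps (fun n => coefs f n + coefs g n).
Definition fps_opp f : fps R := Fps (fun n => - coefs f n).
Definition fps1 : fps R := Fps (fun n => (n == 0)%:R).
Definition fps_mul f g : fps R :=
  Fps (fun n => \sum_(i < n.+1) coefs f i * coefs g (n - i)%N).

Fact fps_addA : associative fps_add.
Proof. by move=> f g h; apply: fpsP => n; exact: addrA. Qed.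
Fact fps_addC : commutative fps_add.
Proof. by move=> f g; apply: fpsP => n; exact: addrC. Qed.
Fact fps_add0 : left_id fps0 fps_add.
Proof. by move=> f; apply: fpsP => n; exact: add0r. Qed.
Fact fps_addN : left_inverse fps0 fps_opp fps_add.
Proof. by move=> f; apply: fpsP => n; exact: addNr. Qed.

HB.instance Definition _ :=
  GRing.isZmodule.Build (fps R) fps_addA fps_addC fps_add0 fps_addN.

Definition fps_trunc N f : {poly R} := \poly_(i < N.+1) coefs f i.

Lemma coef_fps_trunc N f n : (n <= N)%N -> (fps_trunc N f)`_n = coefs f n.
Proof. by move=> le_nN; rewrite coef_poly ltnS le_nN. Qed.

Lemma coef_fps_mul_trunc N f g n : (n <= N)%N ->
  coefs (fps_mul f g) n = (fps_trunc N f * fps_trunc N g)`_n.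
Proof.
move=> le_nN; rewrite coefM /=; apply: eq_bigr => i _.
have le_in : (i <= n)%N by rewrite -ltnS.
by rewrite !coef_fps_trunc // ?(leq_trans _ le_nN) // leq_subr.
Qed.

Fact fps_mulC : commutative fps_mul.
Proof.
by move=> f g; apply: fpsP => n; rewrite !(coef_fps_mul_trunc _ _ (leqnn n)) mulrC.
Qed.

Fact fps_mulA : associative fps_mul.
Proof.
move=> f g h; apply: fpsP => n.
transitivity (fps_trunc n f * (fps_trunc n g * fps_trunc n h))`_n.
  rewrite coefM /=; apply: eq_bigr => i _.
  have le_in : (i <= n)%N by rewrite -ltnS.
  by rewrite coef_fps_trunc // -coef_fps_mul_trunc // leq_subr.
rewrite mulrA coefM /=; apply: eq_bigr => i _.
have le_in : (i <= n)%N by rewrite -ltnS.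
by rewrite (coef_fps_trunc h) ?leq_subr // -coef_fps_mul_trunc.
Qed.

Fact fps_mul1 : left_id fps1 fps_mul.
Proof.
move=> f; apply: fpsP => n /=; rewrite big_ord_recl /= subn0 mul1r.
by rewrite big1 ?addr0 // => i _; rewrite mul0r.
Qed.

Fact fps_mulDl : left_distributive fps_mul fps_add.
Proof.
move=> f g h; apply: fpsP => n /=; rewrite -big_split /=.
by apply: eq_bigr => i _; rewrite mulrDl.
Qed.

Fact fps1_neq0 : fps1 != 0.
Proof.
apply/eqP => /(congr1 (fun f => coefs f 0%N)) /= /eqP.
by rewrite oner_eq0.
Qed.

HB.instance Definition _ := GRing.Zmodule_isComNzRing.Build (fps R)
  fps_mulA fps_mulC fps_mul1 fps_mulDl fps1_neq0.

Definition fps_unit : {pred fps R} :=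
  fun f => coefs f 0%N \is a @GRing.unit R.

(* The coefficients g_0, ..., g_(n-1) of the inverse g of f, obtained by solving
   f_0 g_0 = 1 and \sum_(i <= k) f_(k - i) g_i = 0 for k > 0. *)
Fixpoint fps_inv_seq f n : seq R :=
  if n is m.+1 then
    let s := fps_inv_seq f m in
    rcons s ((coefs f 0%N)^-1 *
             ((m == 0%N)%:R - \sum_(i < m) coefs f (m - i)%N * s`_i))
  else [::].

Definition fps_inv f : fps R :=
  if fps_unit f then Fps (fun n => (fps_inv_seq f n.+1)`_n) else f.

Lemma size_fps_inv_seq f n : size (fps_inv_seq f n) = n.
Proof. by elim: n => //= n IHn; rewrite size_rcons IHn. Qed.

Lemma nth_fps_inv_seq f n i : (i < n)%N ->
  (fps_inv_seq f n)`_i = (fps_inv_seq f i.+1)`_i.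
Proof.
elim: n => // n IHn; rewrite ltnS leq_eqVlt => /orP[/eqP-> //|lt_in].
by rewrite [in LHS]/= nth_rcons size_fps_inv_seq lt_in IHn.
Qed.

Fact fps_mulVx : {in fps_unit, left_inverse 1 fps_inv *%R}.
Proof.
move=> f Uf; apply: fpsP => n; rewrite /fps_inv (Uf : fps_unit f = true).
have {}Uf : coefs f 0%N \is a GRing.unit by exact: Uf.
rewrite [LHS]/= big_ord_recr [X in X + _]/= [X in _ + X]/=.
rewrite nth_rcons size_fps_inv_seq ltnn eqxx subnn mulrAC mulVr // mul1r.
rewrite (eq_bigr (fun i : 'I_n => coefs f (n - i)%N * (fps_inv_seq f n)`_i)).
  by rewrite /= addrC subrK.
by move=> i _; rewrite (nth_fps_inv_seq _ (ltn_ord i)) mulrC.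
Qed.

Fact fps_unitPl f g : g * f = 1 -> fps_unit f.
Proof.
move=> /(congr1 (fun h => coefs h 0%N)) /=; rewrite big_ord1 subnn => gf1.
by apply/unitrPr; exists (coefs g 0%N); rewrite mulrC.
Qed.

Fact fps_invr_out : {in [predC fps_unit], fps_inv =1 id}.
Proof.
by move=> f Uf; rewrite /fps_inv (negbTE (Uf : ~~ fps_unit f)).
Qed.

HB.instance Definition _ := GRing.ComNzRing_hasMulInverse.Build (fps R)
  fps_mulVx fps_unitPl fps_invr_out.

Lemma fps_unitE f : (f \is a GRing.unit) = (coefs f 0%N \is a GRing.unit).
Proof. by []. Qed.

End FormalPowerSeries.

Definition qpoch_partial (N : nat) : {poly int} :=
  \prod_(1 <= m < N.+1) (1 - 'X^m).

(* The infinite product (q;q)_oo. By [coefs_qpoch], its coefficient of q^n is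
   the eventual value of the coefficient of q^n in the partial products. *)
Definition qpoch : fps int := Fps (fun n => (qpoch_partial n)`_n).

Lemma coefs_qpoch (n N : nat) : (n <= N)%N ->
  coefs qpoch n = (qpoch_partial N)`_n.
Proof.
elim: N => [|N IHN]; first by rewrite leqn0 => /eqP->.
rewrite leq_eqVlt => /orP[/eqP-> //|lt_nN].
rewrite IHN // [in RHS]/qpoch_partial big_nat_recr //= -/(qpoch_partial N).
by rewrite mulrBr mulr1 coefB coefMXn lt_nN subr0.
Qed.

Lemma qpoch_unit : qpoch \is a GRing.unit.
Proof. by rewrite fps_unitE /= /qpoch_partial big_geq // coef1. Qed.

Definition p_ (r : int) (n : nat) : int := coefs (qpoch ^ r) n.

(* Main.v *)
From HB Require Import structures.
Require Import Defs.
From mathcomp Require Import all_boot all_order all_algebra.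
From mathcomp Require Import zify ring.

Set Implicit Arguments.
Unset Strict Implicit.
Unset Printing Implicit Defensive.

Import GRing.Theory.
Local Open Scope ring_scope.

(** Write F(q) = (q;q)_oo, P(q) = \sum_(k in Z) q^(k^2) ([theta]),
    M(q) = P(-q) and psi(q) = \sum_(k >= 0) q^(k(k+1)/2).  Three successive
    extractions of the odd-index coefficients lead from n to 2n + 1, 4n + 3 and
    8n + 7.  Each time the series is written as a power of P times a series in
    q^2, so that only the 2-dissection of a power of P matters.

    Two identities make 1/F a power of P up to series in q^2.  Gauss's identity
    M(q) F(q^2) = F(q)^2 ([alt_theta_gauss]) follows from a finite identity in
    the style of Shanks ([shanks]), and P(q) M(q) = M(q^2)^2 ([theta_mul_alt])
    follows from it by rearranging products.  Hence 1/M(q) = P(q) / M(q^2)^2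
    and 1/F(q)^2 = 1/(M(q) F(q^2)).

    The dissection P(q)^2 = P(q^2)^2 + 4q P(q^4) psi(q^8) ([theta_sq_split])
    comes from P(q) = P(q^4) + 2q psi(q^8), which sorts squares by parity, and
    P(q)^2 + M(q)^2 = 2 P(q^2)^2.  The latter is proved without double sums:
    the difference E of the two sides satisfies E(q) = -2 E(q^2), which forces
    E = 0.

    The powers of 2 then accumulate as follows.
    - F^-8 is P^4 times a series in q^2.  Its odd part gives the factor 8, and
      what remains is P^12 times a series in q^2.
    - P^12 = (P(q^2)^2 + 4q P(q^4) psi(q^8))^6 has odd part 24 (...) modulo
      256.  The terms with 256 vanish modulo 8 * 256 = 2^11.
    - What the factor 24 multiplies is P^32 times a series in q^2.  As P is 1
      modulo 2, P^32 is 1 modulo 64, so the odd part is a multiple of 64.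
    Finally 8 * 24 * 64 = 6 * 2^11. *)

(** * Substitutions and truncations of power series *)

Section Substitutions.
Variable R : comUnitRingType.
Implicit Types f g : fps R.

Definition fps_var : fps R := Fps (fun n => if n == 1%N then 1 else 0).

Lemma coefs_varXM k f n :
  coefs (fps_var ^+ k * f) n = if (n < k)%N then 0 else coefs f (n - k).
Proof.
elim: k n => [|k IHk] n; first by rewrite expr0 mul1r subn0.
rewrite exprS -mulrA.
case: n => [|n] /=.
  by rewrite big_ord1 /= mul0r.
rewrite big_ord_recl /= mul0r add0r big_ord_recl /= mul1r.
rewrite [X in _ + X]big1 ?addr0; last by move=> i _; exact: mul0r.
by rewrite -[RHS]IHk /bump /= add1n subn1.
Qed.

Lemma coefs_varX k n : coefs (fps_var ^+ k) n = (n == k)%:R.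
Proof.
rewrite -[_ ^+ k]mulr1 coefs_varXM /=.
case: (ltngtP n k) => // [lt_kn|->]; last by rewrite subnn.
by rewrite subn_eq0 leqNgt lt_kn.
Qed.

Lemma coefsD f g n : coefs (f + g) n = coefs f n + coefs g n.
Proof. by []. Qed.

Lemma coefsN f n : coefs (- f) n = - coefs f n.
Proof. by []. Qed.

Lemma coefs_sum (I : Type) (r : seq I) (P : pred I) (F : I -> fps R) n :
  coefs (\sum_(i <- r | P i) F i) n = \sum_(i <- r | P i) coefs (F i) n.
Proof. by elim/big_rec2: _ => // i x y _ <-. Qed.

Lemma coefsMn f k n : coefs (f *+ k) n = coefs f n *+ k.
Proof. by elim: k => // k IHk; rewrite !mulrS /= IHk. Qed.

(** The substitution of q^2 for q. *)
Definition fps_sq f : fps R :=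
  Fps (fun n => if odd n then 0 else coefs f n./2).

(** Reduces multiplicativity of [fps_sq] to that of polynomial composition. *)
Lemma fps_trunc_sq N f :
  fps_trunc N.*2 (fps_sq f) = fps_trunc N f \Po 'X^2.
Proof.
apply/polyP => i; rewrite coef_poly coef_comp_poly_Xn //.
rewrite dvdn2 divn2 coef_poly /=.
case: (boolP (odd i)) => //= io; rewrite ?if_same //.
by congr (if _ then _ else _); lia.
Qed.

Fact fps_sq_zmod : zmod_morphism fps_sq.
Proof. by move=> f g; apply: fpsP => n /=; case: odd; rewrite ?subr0. Qed.

Fact fps_sq_monoid : monoid_morphism fps_sq.
Proof.
split.
  by apply: fpsP => -[|[|n]] //=; case: odd.
move=> f g; apply: fpsP => n.
have le_n : (n <= n.*2)%N by lia.
have -> : coefs (fps_sq f * fps_sq g) n =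
    (fps_trunc n.*2 (fps_sq f) * fps_trunc n.*2 (fps_sq g))`_n.
  exact: coef_fps_mul_trunc.
rewrite !fps_trunc_sq -comp_polyM coef_comp_poly_Xn // dvdn2 divn2.
rewrite [LHS]/=; case: (odd n) => //=.
have le_n2 : (n./2 <= n)%N by lia.
by rewrite -(coef_fps_mul_trunc f g le_n2).
Qed.

HB.instance Definition _ := GRing.isZmodMorphism.Build _ _ fps_sq fps_sq_zmod.
HB.instance Definition _ :=
  GRing.isMonoidMorphism.Build _ _ fps_sq fps_sq_monoid.

(** The substitution of -q for q. *)
Definition fps_alt f : fps R := Fps (fun n => (-1) ^+ n * coefs f n).

Fact fps_alt_zmod : zmod_morphism fps_alt.
Proof. by move=> f g; apply: fpsP => n /=; rewrite mulrBr. Qed.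

Fact fps_alt_monoid : monoid_morphism fps_alt.
Proof.
split; first by apply: fpsP => -[|n] /=; rewrite ?mulr1 ?mulr0.
move=> f g; apply: fpsP => n /=; rewrite mulr_sumr.
apply: eq_bigr => i _; rewrite mulrACA -exprD subnKC //.
by rewrite -ltnS.
Qed.

HB.instance Definition _ := GRing.isZmodMorphism.Build _ _ fps_alt fps_alt_zmod.
HB.instance Definition _ :=
  GRing.isMonoidMorphism.Build _ _ fps_alt fps_alt_monoid.

Lemma fps_sq_var : fps_sq fps_var = fps_var ^+ 2.
Proof.
apply: fpsP => n; rewrite coefs_varX.
by case: n => [|[|[|[|n]]]] //=; case: odd.
Qed.

Lemma fps_alt_var : fps_alt fps_var = - fps_var.
Proof.
by apply: fpsP => -[|[|n]] /=; rewrite ?mulr0 ?oppr0 // expr1 mulr1.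
Qed.

Lemma fps_alt_sq f : fps_alt (fps_sq f) = fps_sq f.
Proof.
apply: fpsP => n /=; case: (boolP (odd n)) => on; first by rewrite mulr0.
by rewrite -signr_odd (negbTE on) mul1r.
Qed.

Lemma coefs_sqD_odd f g n :
  coefs (fps_sq f + fps_var * fps_sq g) n.*2.+1 = coefs g n.
Proof.
rewrite -[fps_var]expr1.
rewrite coefsD coefs_varXM /= odd_double /= add0r subn1 /=.
by rewrite odd_double doubleK.
Qed.

Definition fps_eqmod N f g := forall n, (n <= N)%N -> coefs f n = coefs g n.

Lemma fps_eqmod_eq f g : (forall N, fps_eqmod N f g) -> f = g.
Proof. by move=> fg; apply: fpsP => n; apply: (fg n). Qed.

Lemma fps_eqmodM N f f' g g' :
  fps_eqmod N f f' -> fps_eqmod N g g' -> fps_eqmod N (f * g) (f' * g').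
Proof.
move=> ff gg n le_nN /=; apply: eq_bigr => i _; have := ltn_ord i.
by move=> lt_i; rewrite ff ?gg //; lia.
Qed.

Lemma fps_eqmod_alt N f g :
  fps_eqmod N f g -> fps_eqmod N (fps_alt f) (fps_alt g).
Proof. by move=> fg n le_nN /=; rewrite fg. Qed.

Lemma fps_eqmod_sq N f g :
  fps_eqmod N f g -> fps_eqmod N (fps_sq f) (fps_sq g).
Proof. by move=> fg n le_nN /=; rewrite fg //; lia. Qed.

Lemma fps_eqmodDvarX N f g : fps_eqmod N (f + fps_var ^+ N.+1 * g) f.
Proof.
move=> n le_nN.
by rewrite coefsD coefs_varXM ltnS le_nN addr0.
Qed.

Lemma fps_eqmod_sym N f g : fps_eqmod N f g -> fps_eqmod N g f.
Proof. by move=> fg n /fg. Qed.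

Lemma fps_eqmod_trans N f g h :
  fps_eqmod N f g -> fps_eqmod N g h -> fps_eqmod N f h.
Proof. by move=> fg gh n le_n; rewrite fg ?gh. Qed.

End Substitutions.

(** * The Euler product under the change of sign of q *)

Local Notation q := (fps_var int).

Definition qpoch_prod N : fps int := \prod_(1 <= m < N.+1) (1 - q ^+ m).

Lemma qpoch_prodS N : qpoch_prod N.+1 = qpoch_prod N * (1 - q ^+ N.+1).
Proof. by rewrite /qpoch_prod big_nat_recr. Qed.

Lemma coefs_qpoch_prod N n : coefs (qpoch_prod N) n = (qpoch_partial N)`_n.
Proof.
elim: N n => [|N IHN] n.
  by rewrite /qpoch_prod /qpoch_partial !big_geq // coef1.
rewrite qpoch_prodS mulrBr mulr1 mulrC coefsD coefsN coefs_varXM.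
rewrite /qpoch_partial big_nat_recr // -/(qpoch_partial N).
by rewrite [in RHS]/= mulrBr mulr1 coefB coefMXn -!IHN.
Qed.

Lemma qpoch_prod_eqmod K N : (N <= K)%N -> fps_eqmod N (qpoch_prod K) qpoch.
Proof.
move=> le_NK n le_nN.
by rewrite coefs_qpoch_prod (coefs_qpoch (leq_trans le_nN le_NK)).
Qed.

(** In (q;q)(-q;-q) the even factors occur twice and the odd ones pair up to
    1 - q^(2k) for odd k; the third product supplies these for even k. *)
Lemma qpoch_prod_alt N :
  fps_alt (qpoch_prod N.*2) * qpoch_prod N.*2 * fps_sq (fps_sq (qpoch_prod N)) =
  fps_sq (qpoch_prod N) ^+ 2 * fps_sq (qpoch_prod N.*2).
Proof.
elim: N => [|N IHN].
  by rewrite /qpoch_prod double0 !big_geq // !rmorph1 expr1n !mul1r.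
rewrite doubleS !qpoch_prodS.
have sqX k : fps_sq (1 - q ^+ k) = 1 - q ^+ k.*2.
  by rewrite rmorphB rmorph1 rmorphXn /= fps_sq_var -exprM mul2n.
have altX k : fps_alt (1 - q ^+ k) = 1 - (-1) ^+ k * q ^+ k.
  by rewrite rmorphB rmorph1 rmorphXn /= fps_alt_var [in LHS]exprNn.
rewrite !rmorphM /= !sqX !altX.
rewrite -![(-1) ^+ _.*2.+1]signr_odd -![(-1) ^+ _.*2.+2]signr_odd /=.
rewrite !odd_double /=.
have -> : 1 - q ^+ (N.*2.+1).*2 = (1 - q ^+ N.*2.+1) * (1 + q ^+ N.*2.+1).
  by rewrite -[(N.*2.+1).*2]mul2n mulnC exprM; ring.
rewrite -!doubleS.
move: (q ^+ N.*2.+1) (q ^+ N.+1.*2) (q ^+ N.+1.*2.*2) => x y z.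
transitivity (fps_alt (qpoch_prod N.*2) * qpoch_prod N.*2 *
  fps_sq (fps_sq (qpoch_prod N)) *
  ((1 - x) * (1 + x) * (1 - y) ^+ 2 * (1 - z))).
  by rewrite expr0 expr1; ring.
by rewrite IHN; ring.
Qed.

Lemma qpoch_alt :
  fps_alt qpoch * qpoch * fps_sq (fps_sq qpoch) = fps_sq qpoch ^+ 3.
Proof.
apply: fps_eqmod_eq => N.
have e1 : fps_eqmod N (qpoch_prod N) qpoch by exact: qpoch_prod_eqmod.
have e2 : fps_eqmod N (qpoch_prod N.*2) qpoch by apply: qpoch_prod_eqmod; lia.
apply: (@fps_eqmod_trans _ _ _ (fps_alt (qpoch_prod N.*2) * qpoch_prod N.*2 *
   fps_sq (fps_sq (qpoch_prod N)))).
  apply: fps_eqmod_sym; apply: fps_eqmodM.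
    by apply: fps_eqmodM => //; apply: fps_eqmod_alt.
  by do 2!apply: fps_eqmod_sq.
rewrite qpoch_prod_alt [_ ^+ 3]exprSr !expr2.
by do 2?apply: fps_eqmodM; apply: fps_eqmod_sq.
Qed.

(** * Theta series *)

Definition is_square n := [exists k : 'I_n.+1, (k ^ 2 == n)%N].

Lemma is_squareP n : reflect (exists k, n = k ^ 2)%N (is_square n).
Proof.
apply: (iffP existsP) => [[k /eqP <-]|[k ->]]; first by exists k.
have lt_k : (k < (k ^ 2).+1)%N by nia.
by exists (Ordinal lt_k).
Qed.

(** The sum of q^(k^2) over all integers k; nonzero squares are hit twice. *)
Definition theta : fps int :=
  Fps (fun n => if n == 0%N then 1 else (is_square n)%:R *+ 2).

(** The sum of q^(k(k+1)/2) over k >= 0: an integer n is triangular exactly when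
    8n + 1 is a square. *)
Definition psi : fps int := Fps (fun n => (is_square (8 * n + 1))%:R).

Lemma is_square_mul4 n : is_square (4 * n) = is_square n.
Proof.
apply/is_squareP/is_squareP => -[k]; last first.
  by move=> ->; exists (2 * k)%N; rewrite expnMn.
move=> nk; exists k./2.
have ok : ~~ odd k.
  by have := congr1 odd nk; rewrite oddM oddX /= => <-.
have := odd_double_half k; rewrite (negbTE ok) add0n -mul2n => kE.
by move: nk; rewrite -{1}kE expnMn => /eqP; rewrite eqn_pmul2l // => /eqP.
Qed.

Lemma is_square_odd n : odd n -> is_square n -> (n %% 8 = 1)%N.
Proof.
move=> on /is_squareP[k nk]; move: on; rewrite nk oddX /= => ok.
have oh := odd_double_half (k./2 * k./2.+1)%N.
have := odd_double_half k; rewrite ok => <-.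
move: oh; rewrite oddM /= andbN add0n => oh.
have -> : ((true + k./2.*2) ^ 2 = (k./2 * k./2.+1)%N * 4 + 1)%N.
  by rewrite /=; lia.
by rewrite -oh; lia.
Qed.

Lemma is_square_mod4 n : is_square n -> (n %% 4 < 2)%N.
Proof.
case: (boolP (odd n)) => [on /(is_square_odd on)|on /is_squareP[k nk]].
  by lia.
have ok : ~~ odd k by move: on; rewrite nk oddX.
have := odd_double_half k; rewrite (negbTE ok) add0n -mul2n => kE.
by rewrite nk -kE expnMn modnMr.
Qed.

(** Even squares are 4 times a square, and odd ones are 8 times a triangular
    number plus 1. *)
Lemma theta_split :
  theta = fps_sq (fps_sq theta) + (q * fps_sq (fps_sq (fps_sq psi))) *+ 2.
Proof.
apply: fpsP => n; rewrite coefsD coefsMn -[q]expr1 coefs_varXM subn1 ltnS leqn0.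
case: (posnP n) => [-> //=|n_gt0].
case: (boolP (odd n)) => on.
  have -> : coefs (fps_sq (fps_sq theta)) n = 0 by rewrite /= on.
  rewrite add0r [LHS]/= (negbTE (lt0n_neq0 n_gt0)); congr (_ *+ 2); rewrite /=.
  case: (boolP (is_square n)) => [sq_n|nsq_n].
    have n8 := is_square_odd on sq_n.
    rewrite ifF; last by lia.
    rewrite ifF; last by lia.
    rewrite ifF; last by lia.
    have -> : (8 * (n.-1./2./2./2) + 1 = n)%N by lia.
    by rewrite sq_n.
  case: ifP => // o1; case: ifP => // o2; case: ifP => // o3.
  have -> : (8 * (n.-1./2./2./2) + 1 = n)%N by lia.
  by rewrite (negbTE nsq_n).
have -> : coefs (fps_sq (fps_sq (fps_sq psi))) n.-1 = 0.
  by rewrite /= ifT //; lia.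
rewrite mul0rn addr0 /= (negbTE on) (negbTE (lt0n_neq0 n_gt0)).
case: ifP => o2.
  case: (boolP (is_square n)) => // /is_square_mod4; lia.
rewrite ifF; last by lia.
have {1}-> : n = (4 * (n./2./2))%N by lia.
by rewrite is_square_mul4.
Qed.

Lemma theta_altD : theta + fps_alt theta = fps_sq (fps_sq theta) *+ 2.
Proof.
rewrite {1 2}theta_split rmorphD /= rmorphMn rmorphM /= !fps_alt_sq fps_alt_var.
by ring.
Qed.

(** * Gauss's product for the alternating theta series *)

Definition theta_partial n : fps int :=
  1 + (\sum_(1 <= s < n.+1) (-1) ^+ s * q ^+ (s ^ 2)) *+ 2.

Lemma theta_partial_eqmod N : fps_eqmod N (theta_partial N) (fps_alt theta).
Proof.
move=> n le_nN; rewrite coefsD coefsMn coefs_sum.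
rewrite (eq_bigr (fun s : nat => if (s ^ 2 == n)%N then (-1) ^+ s else 0));
  last first.
  move=> s _; rewrite mulrC coefs_varXM.
  have -> : (-1 : fps int) ^+ s = if odd s then -1 else 1.
    by rewrite -signr_odd; case: odd.
  rewrite -[in RHS]signr_odd.
  case: ltngtP => [|gt_ns|->]; case: odd => //=; rewrite ?subnn //.
    by rewrite subn_eq0 leqNgt gt_ns.
  by rewrite subn_eq0 leqNgt gt_ns.
rewrite -big_mkcond /=.
case: (posnP n) => [->|n_gt0].
  rewrite big_nat_cond big1 /= ?mul0rn ?addr0 // => s.
  by case: s => [|s]; rewrite ?andbF // expn_eq0.
rewrite add0r.
case: (is_squareP n) => [[k nk]|nsq_n]; last first.
  rewrite big1 ?mul0rn ?mulr0 // => s /eqP sn.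
  by case: nsq_n; exists s.
rewrite (eq_bigl (fun s => s == k)); last by move=> s; rewrite nk /= eqn_exp2r.
rewrite big_nat1_eq ifT; last by nia.
rewrite -[(-1) ^+ k]signr_odd -[(-1) ^+ n]signr_odd nk oddX /=.
by case: odd.
Qed.

(** With P_n = \prod_(k <= n) (1 - q^k) / (1 + q^k), Shanks's method expresses
    the partial sums of the alternating theta series as combinations of the
    P_n / P_s.  These are the coefficients after multiplication by
    \prod_(k <= n) (1 + q^k), which removes all denominators. *)
Definition shanks_term n s : fps int :=
  (-1) ^+ s * (\prod_(s.+1 <= k < n.+1) (1 - q ^+ k)) *
  \prod_(1 <= k < s) (1 + q ^+ k).

(** The bracket is -q^(s(n+1)) ((1 - q^s) + q^(n+1) (1 + q^s)); the factor
    1 - q^s extends the first product of the term and 1 + q^s the second, so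
    each summand is a difference of consecutive values of one expression in s.
    In the step of [shanks] from n to n + 1, these differences are what the
    terms with s <= n gain over 1 + q^(n+1) times their former values. *)
Lemma shanks_telescope n m : (m <= n)%N ->
  \sum_(1 <= s < m.+1) shanks_term n s *
    (q ^+ (s * n.+2) * (1 - q ^+ n.+1) - q ^+ (s * n.+1) * (1 + q ^+ n.+1)) =
  q ^+ n.+1 * qpoch_prod n -
  (-1) ^+ m * q ^+ (m.+1 * n.+1) *
    (\prod_(m.+1 <= k < n.+1) (1 - q ^+ k)) *
    \prod_(1 <= k < m.+1) (1 + q ^+ k).
Proof.
elim: m => [_|m IHm lt_mn].
  rewrite (big_geq (leqnn 1)) (big_geq (leqnn 1)) mul1n -/(qpoch_prod n) expr0.
  by ring.
rewrite big_nat_recr //= IHm 1?ltnW // /shanks_term.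
rewrite [in X in X + _](big_ltn (m := m.+1)) ?ltnS //.
rewrite [in RHS](big_nat_recr m.+1) //=.
move: (\prod_(m.+2 <= k < n.+1) _) (\prod_(1 <= k < m.+1) _) => A B.
have -> : q ^+ (m.+1 * n.+2) = q ^+ (m.+1 * n.+1) * q ^+ m.+1.
  by rewrite -exprD; congr (_ ^+ _); lia.
have -> : q ^+ (m.+2 * n.+1) = q ^+ (m.+1 * n.+1) * q ^+ n.+1.
  by rewrite -exprD; congr (_ ^+ _); lia.
move: (q ^+ (m.+1 * n.+1)) => C; rewrite [(-1) ^+ m.+1]exprS.
ring.
Qed.

(** Every summand with s >= 1 is divisible by q^(n+1), so modulo q^(n+1) the
    partial theta sum is \prod_(k <= n) (1 - q^k) / (1 + q^k). *)
Lemma shanks n :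
  (\prod_(1 <= k < n.+1) (1 + q ^+ k)) * theta_partial n =
  qpoch_prod n + (\sum_(1 <= s < n.+1) shanks_term n s * q ^+ (s * n.+1)) *+ 2.
Proof.
elim: n => [|n IHn].
  by rewrite /theta_partial /qpoch_prod !(big_geq (leqnn 1)); ring.
have tel := shanks_telescope (leqnn n).
rewrite (big_geq (leqnn n.+1)) in tel.
have thetaS : theta_partial n.+1 =
    theta_partial n + ((-1) ^+ n.+1 * q ^+ (n.+1 * n.+1)) *+ 2.
  by rewrite /theta_partial big_nat_recr //= mulnn mulrnDl addrA.
rewrite thetaS big_nat_recr //= qpoch_prodS [in RHS]big_nat_recr //=.
rewrite {2}/shanks_term (big_geq (leqnn n.+2)).
(* Isolate the telescoping sum: passing from n to n + 1 multiplies the term of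
   index s by 1 - q^(n+1) and the product on the left by 1 + q^(n+1). *)
have -> : \sum_(1 <= s < n.+1) shanks_term n.+1 s * q ^+ (s * n.+2) =
  \sum_(1 <= s < n.+1) (shanks_term n s *
    (q ^+ (s * n.+2) * (1 - q ^+ n.+1) - q ^+ (s * n.+1) * (1 + q ^+ n.+1)) +
    shanks_term n s * q ^+ (s * n.+1) * (1 + q ^+ n.+1)).
  apply: eq_big_nat => s /andP[s_gt0 lt_sn].
  rewrite /shanks_term [in LHS]big_nat_recr //=.
  by ring.
rewrite big_split /= tel -mulr_suml.
have -> : q ^+ (n.+1 * n.+2) = q ^+ (n.+1 * n.+1) * q ^+ n.+1.
  by rewrite -exprD; congr (_ ^+ _); lia.
move: IHn; rewrite ![(-1) ^+ n.+1]exprS.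
move: (theta_partial n) (\sum_(1 <= s < n.+1) _).
move: (\prod_(1 <= k < n.+1) _) (qpoch_prod n) => D Q T W IHn.
transitivity (D * T * (1 + q ^+ n.+1) +
  (D * (1 + q ^+ n.+1) * (- ((-1) ^+ n * q ^+ (n.+1 * n.+1)))) *+ 2).
  by ring.
by rewrite IHn; ring.
Qed.

Lemma qpoch_prod_sq n :
  qpoch_prod n * \prod_(1 <= k < n.+1) (1 + q ^+ k) = fps_sq (qpoch_prod n).
Proof.
rewrite /qpoch_prod -big_split rmorph_prod /=; apply: eq_bigr => k _.
rewrite rmorphB rmorph1 rmorphXn /= fps_sq_var -exprM mulnC exprM; ring.
Qed.

(** Multiply the limit of [shanks] by (q;q)_oo, using
    (1 - q^k)(1 + q^k) = 1 - q^(2k). *)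
Lemma alt_theta_gauss : fps_alt theta * fps_sq qpoch = qpoch ^+ 2.
Proof.
apply: fps_eqmod_eq => N; have qN := qpoch_prod_eqmod (leqnn N).
apply: (@fps_eqmod_trans _ _ _ (theta_partial N * fps_sq (qpoch_prod N))).
  apply: fps_eqmod_sym; apply: fps_eqmodM; first exact: theta_partial_eqmod.
  exact: fps_eqmod_sq.
apply: (@fps_eqmod_trans _ _ _ (qpoch_prod N ^+ 2)); last first.
  by rewrite !expr2; apply: fps_eqmodM.
rewrite -qpoch_prod_sq mulrCA [theta_partial N * _]mulrC shanks.
rewrite (eq_big_nat _ _ (F2 := fun s =>
    q ^+ N.+1 * (shanks_term N s * q ^+ (s.-1 * N.+1)))); last first.
  by move=> [|s] // _; rewrite mulSn exprD; ring.
rewrite -mulr_sumr mulrDr -expr2 -mulrnAr mulrCA.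
exact: fps_eqmodDvarX.
Qed.

(** * The 2-dissection of the square of theta *)

Lemma fps_int_double_inj : injective (fun f : fps int => f *+ 2).
Proof.
move=> f g fg; apply: fpsP => n.
by have := congr1 (fun h : fps int => coefs h n) fg; rewrite !coefsMn; lia.
Qed.

(** Odd coefficients vanish at once, and the coefficient of index 2k is -2 times
    that of index k: descend to the index 0, where the coefficient c satisfies
    c = -2c. *)
Lemma fps_sq_fixpoint_eq0 (f : fps int) : f = - (fps_sq f *+ 2) -> f = 0.
Proof.
move=> fE; apply: fpsP => n /=; elim/ltn_ind: n => n IHn.
have := congr1 (fun h : fps int => coefs h n) fE; rewrite coefsN coefsMn.
case: (posnP n) => [-> /=|n_gt0]; first by lia.
have -> : coefs (fps_sq f) n = 0.
  by rewrite /=; case: ifP => // _; apply: IHn; lia.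
by rewrite mul0rn oppr0.
Qed.

(** Gauss's identity at q, -q and q^2 turns this into [qpoch_alt]; the common
    factor cancelled is F(q^4)^2 F(q^2)^2, where F = (q;q)_oo. *)
Lemma theta_mul_alt : theta * fps_alt theta = fps_sq (fps_alt theta) ^+ 2.
Proof.
have uF : fps_sq (fps_sq qpoch) ^+ 2 * fps_sq qpoch ^+ 2 \is a GRing.unit.
  by rewrite unitrM !unitrX ?rmorph_unit ?qpoch_unit.
apply: (mulrI uF).
have altK : fps_alt (fps_alt theta) = theta.
  by apply: fpsP => n /=; rewrite mulrA -expr2 sqrr_sign mul1r.
have aux (A : comPzRingType) (F4 M2 F2 M G F P : A) :
    G * F * F4 = F2 ^+ 3 ->
    M * F2 = F ^+ 2 -> P * F2 = G ^+ 2 -> M2 * F4 = F2 ^+ 2 ->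
    F4 ^+ 2 * F2 ^+ 2 * (P * M) = F4 ^+ 2 * F2 ^+ 2 * M2 ^+ 2.
  move=> h g0 g1 g2.
  transitivity ((F4 * (M * F2)) * (F4 * (P * F2))); first by ring.
  transitivity (F2 ^+ 2 * (M2 * F4) ^+ 2); last by ring.
  rewrite g0 g1 g2; transitivity ((G * F * F4) ^+ 2); first by ring.
  by rewrite h; ring.
have g0 := alt_theta_gauss.
have g1 := congr1 (@fps_alt int) alt_theta_gauss.
rewrite rmorphXn rmorphM /= altK fps_alt_sq in g1.
have g2 := congr1 (@fps_sq int) alt_theta_gauss.
rewrite rmorphXn rmorphM /= in g2.
exact: (aux _ _ _ _ _ _ _ _ qpoch_alt g0 g1 g2).
Qed.

(** Let E be the difference of the sides, P = [theta] and M(q) = P(-q).  From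
    P(q) + M(q) = 2 P(q^4) and P(q) M(q) = M(q^2)^2 one gets
    P^2 + M^2 = 4 P(q^4)^2 - 2 M(q^2)^2, whence E(q) = -2 E(q^2). *)
Lemma theta_sqD : theta ^+ 2 + fps_alt theta ^+ 2 = fps_sq theta ^+ 2 *+ 2.
Proof.
apply/eqP; rewrite -subr_eq0; apply/eqP; apply: fps_sq_fixpoint_eq0.
have h : theta ^+ 2 + fps_alt theta ^+ 2 =
  fps_sq (fps_sq theta) ^+ 2 *+ 4 - fps_sq (fps_alt theta) ^+ 2 *+ 2.
  rewrite -theta_mul_alt.
  transitivity ((theta + fps_alt theta) ^+ 2 - theta * fps_alt theta *+ 2).
    by ring.
  by rewrite theta_altD; ring.
by rewrite {1}h !(rmorphB, rmorphD, rmorphMn, rmorphXn) /=; ring.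
Qed.

(** Half the sum of P(q)^2 + P(-q)^2 and
    P(q)^2 - P(-q)^2 = 2 P(q^4) * 4q psi(q^8). *)
Lemma theta_sq_split :
  theta ^+ 2 =
  fps_sq theta ^+ 2 + (q * fps_sq (fps_sq (theta * fps_sq psi))) *+ 4.
Proof.
apply: fps_int_double_inj.
transitivity (theta ^+ 2 + fps_alt theta ^+ 2 +
  (theta + fps_alt theta) * (theta *+ 2 - (theta + fps_alt theta))).
  by ring.
have -> : theta *+ 2 - (theta + fps_alt theta) =
    (q * fps_sq (fps_sq (fps_sq psi))) *+ 4.
  by rewrite theta_altD {1}theta_split; ring.
by rewrite theta_sqD theta_altD !rmorphM /=; ring.
Qed.

(** * Powers of theta and the three extractions *)

Lemma expr_pow2_1D2 (A : comPzRingType) (t : A) k :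
  exists y, (1 + t *+ 2) ^+ (2 ^ k) = 1 + y *+ (2 ^ k.+1).
Proof.
elim: k => [|k [y IHk]]; first by exists t; rewrite expr1.
exists (y + y ^+ 2 *+ 2 ^ k).
rewrite expnSr exprM IHk [(2 ^ k.+2)%N]expnS mulrnDl -mulrnA.
have -> : (2 ^ k * (2 * 2 ^ k.+1) = 2 ^ k.+1 * 2 ^ k.+1)%N.
  by rewrite !expnS; lia.
by move: (2 ^ k.+1)%N => m; rewrite !mulrnA; ring.
Qed.

Lemma theta_expr32 : exists y, theta ^+ 32 = 1 + y *+ 64.
Proof.
pose t : fps int := Fps (fun n => if n == 0%N then 0 else (is_square n)%:R).
have -> : theta = 1 + t *+ 2.
  apply: fpsP => n; rewrite coefsD coefsMn /=.
  by case: eqP => _; rewrite ?mul0rn ?addr0 ?add0r.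
exact: (expr_pow2_1D2 _ 5).
Qed.

Lemma coefs_sq_odd (f : fps int) n : coefs (fps_sq f) n.*2.+1 = 0.
Proof. by rewrite /= odd_double. Qed.

Lemma alt_theta_unit : fps_alt theta \is a GRing.unit.
Proof. by rewrite fps_unitE. Qed.

Lemma alt_thetaV :
  (fps_alt theta)^-1 = theta * fps_sq (fps_alt theta)^-1 ^+ 2.
Proof.
apply: (mulrI alt_theta_unit); rewrite mulrA [_ * theta]mulrC theta_mul_alt.
rewrite divrr ?alt_theta_unit // -exprMn rmorphV ?alt_theta_unit //=.
by rewrite divrr ?expr1n // rmorph_unit ?alt_theta_unit.
Qed.

Lemma qpochV_sq : qpoch^-1 ^+ 2 = (fps_alt theta)^-1 * fps_sq qpoch^-1.
Proof.
rewrite exprVn -alt_theta_gauss.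
rewrite invrM ?alt_theta_unit ?rmorph_unit ?qpoch_unit //.
by rewrite mulrC rmorphV ?qpoch_unit.
Qed.

(** In the next three lemmas d is the substitution of x^2 for x, P is [theta], m
    and f are the inverses of P(-x) and of the Euler product, and the relations
    between them are the identities proved above.

    Here f^8 = m^4 d(f)^4 = P^4 d(m^8 f^4), and the square of
    P^2 = d(P)^2 + 4x d(d X) has odd part 8x d(P)^2 d(d X); substituting for m
    and f again turns P^2 m^8 f^4 into P^12 times an image of d. *)
Lemma first_dissection (A : comPzRingType) (d : {rmorphism A -> A})
    (x P X m f : A) :
    d x = x ^+ 2 -> P ^+ 2 = d P ^+ 2 + x * d (d X) *+ 4 ->
    m = P * d m ^+ 2 -> f ^+ 2 = m * d f ->
  f ^+ 8 = d ((P ^+ 4 + x * d X ^+ 2 *+ 16) * m ^+ 8 * f ^+ 4) +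
           x * d ((P ^+ 12 * d (X * m ^+ 20 * f ^+ 2)) *+ 8).
Proof.
move=> dx PE mE fE.
have f4 : f ^+ 4 = P ^+ 2 * d (m ^+ 4 * f ^+ 2).
  transitivity ((m * d f) ^+ 2); first by rewrite -fE; ring.
  by rewrite {1}mE; ring.
have m8 : m ^+ 8 = P ^+ 8 * d (m ^+ 16) by rewrite {1}mE; ring.
transitivity ((P ^+ 2) ^+ 2 * d (m ^+ 8 * f ^+ 4)).
  transitivity ((f ^+ 4) ^+ 2); first by ring.
  by rewrite {1}f4; ring.
have -> : P ^+ 12 * d (X * m ^+ 20 * f ^+ 2) =
    P ^+ 2 * d X * (m ^+ 8 * f ^+ 4).
  by rewrite m8 f4; ring.
by rewrite {1}PE; ring: dx.
Qed.

(** The odd part of (u + 4v)^6, with v odd, is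
    6 * 4 u^5 v + 20 * 4^3 u^3 v^3 + 6 * 4^5 u v^5, which is 24 u^5 v modulo
    256. *)
Lemma second_dissection (A : comPzRingType) (d : {rmorphism A -> A})
    (x P X Y : A) :
    d x = x ^+ 2 -> P ^+ 2 = d P ^+ 2 + x * d (d X) *+ 4 ->
  exists a z,
    P ^+ 12 * d Y = d a + x * d (P ^+ 10 * d X * Y *+ 24 + z *+ 256).
Proof.
move=> dx PE; pose W := d X.
exists ((P ^+ 12 + x * P ^+ 8 * W ^+ 2 *+ 240 +
  x ^+ 2 * P ^+ 4 * W ^+ 4 *+ 3840 + x ^+ 3 * W ^+ 6 *+ 4096) * Y).
exists ((x * P ^+ 6 * W ^+ 3 *+ 5 + x ^+ 2 * P ^+ 2 * W ^+ 5 *+ 24) * Y).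
transitivity ((P ^+ 2) ^+ 6 * d Y); first by ring.
by rewrite {1}PE /W; ring: dx.
Qed.

(** Each factor m and each pair of factors f contributes one factor P; the
    exponents of P add up to 11 + 21 = 32, where 21 = 20 + 1. *)
Lemma third_dissection (A : comPzRingType) (d : {rmorphism A -> A})
    (P t m f : A) :
    m = P * d m ^+ 2 -> f ^+ 2 = m * d f ->
  P ^+ 10 * d (P * d t) * ((P * d t) * m ^+ 20 * f ^+ 2) =
  P ^+ 32 * d (P * d t * t * m ^+ 42 * f).
Proof.
move=> mE fE.
have m21 : m ^+ 21 = P ^+ 21 * d (m ^+ 42) by rewrite {1}mE; ring.
transitivity (P ^+ 11 * d (P * d t) * d t * m ^+ 21 * d f).
  by rewrite fE; ring.
by rewrite m21; ring.
Qed.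

Theorem theorem3p10 (n : nat) :
  (p_ (- 8) (8 * n + 7)%N = 0 %[mod 2 ^+ 11])%Z.
Proof.
pose m := (fps_alt theta)^-1; pose f := qpoch^-1.
pose X := theta * fps_sq psi.
have coefsMnD (g h : fps int) i j k :
    coefs (g *+ i + h *+ j) k = coefs g k *+ i + coefs h k *+ j.
  by rewrite coefsD !coefsMn.
have mE : m = theta * fps_sq m ^+ 2 by exact: alt_thetaV.
have fE : f ^+ 2 = m * fps_sq f by exact: qpochV_sq.
have -> : p_ (- 8) (8 * n + 7) = coefs (f ^+ 8) (n.*2.+1.*2.+1.*2.+1).
  have -> : (8 * n + 7 = n.*2.+1.*2.+1.*2.+1)%N by lia.
  by rewrite /p_ exprVn.
rewrite (first_dissection (fps_sq_var _) theta_sq_split mE fE).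
rewrite coefs_sqD_odd coefsMn.
have [a [z ->]] :=
  second_dissection (X * m ^+ 20 * f ^+ 2) (fps_sq_var _) theta_sq_split.
rewrite coefs_sqD_odd coefsMnD (third_dissection _ mE fE).
have [y ->] := theta_expr32.
rewrite mulrDl mul1r coefsD coefs_sq_odd add0r mulrnAl coefsMn.
move: (coefs _ _) (coefs _ _) => u v.
apply/eqP; rewrite eqz_mod_dvd subr0; apply/dvdzP.
by exists (v *+ 6 + u); ring.
Qed.
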